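(* Let $R,S\le M_n(\mathbb C)$ be isomorphic quantum graphs. Then their panoramic polynomials $p_R$ and $p_S$ are orthogonally equivalent.
   Context: $R\le M_n(\mathbb C)$ means $R$ is a complex subspace. $\mathrm{tr}$ is the normalized trace ($\mathrm{tr}(1_n)=1$), and $M_n(\mathbb C)$ has the inner product $\langle a|b\rangle=\mathrm{tr}(a^\dagger b)$. A subspace $R\le M_n(\mathbb C)$ is a quantum graph if $\mathrm{tr}(a)=0$ and $a^\dagger\in R$ for all $a\in R$. Quantum graphs $R,S\le M_n(\mathbb C)$ are isomorphic if $uRu^\dagger=S$ for some unitary $u\in M_n(\mathbb C)$. An orthonormal basis of $R$ is Hermitian if each of its elements is Hermitian (every quantum graph has one). For $d=\dim R$ and any Hermitian orthonormal basis $\{a_1,\dots,a_d\}$ of $R$, the panoramic polynomial of $R$ is $p_R(t_1,\dots,t_d)=\det(t_1a_1+\cdots+t_da_d)\in\mathbb R[t_1,\dots,t_d]$, defined up to orthogonal equivalence. Polynomials $p_1,p_2\in\mathbb R[t_1,\dots,t_d]$ are orthogonally equivalent if there is an orthogonal matrix $r\in O(d)$ with $p_1(t)=p_2(rt)$. *)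

(* Defs.v *)
From HB Require Import structures.
From mathcomp Require Import all_boot all_order all_algebra.
From mathcomp Require Import complex reals.
From mathcomp Require Import mpoly ring.

Set Implicit Arguments.
Unset Strict Implicit.
Unset Printing Implicit Defensive.

Import Order.TTheory GRing.Theory Num.Theory.

Local Open Scope ring_scope.
Local Open Scope sesquilinear_scope.

(* The complex numbers are R[i] for R : realType, and a ^t* is the
   conjugate transpose of a. *)

Section QuantumGraphs.
Variables (R : realType) (n : nat).
Local Notation C := (R[i]).
Implicit Types (V W : {vspace 'M[C]_n}) (a b u : 'M[C]_n).

Definition normalized_trace a : C := n%:R^-1 * \tr a.

Definition trace_inner a b : C := normalized_trace (a ^t* *m b).

Definition quantum_graph V : Prop :=
  forall a, a \in V -> normalized_trace a = 0 /\ a ^t* \in V.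

Definition quantum_graph_isomorphic V W : Prop :=
  exists2 u, u \is unitarymx &
    forall b, b \in W <-> exists2 a, a \in V & b = u *m a *m u ^t*.

Definition hermitian_orthonormal_basis V (s : (\dim V).-tuple 'M[C]_n) : Prop :=
  [/\ basis_of V s,
      forall i j, trace_inner (tnth s i) (tnth s j) = (i == j)%:R
    & forall i, tnth s i \is hermsymmx].

Definition pencil d (s : d.-tuple 'M[C]_n) : 'M[{mpoly C[d]}]_n :=
  \sum_(i < d) 'X_i *: map_mx (@mpolyC d C) (tnth s i).

(* p_R is only defined up to the choice of a Hermitian orthonormal basis, so
   it is a predicate on p.  The determinant lives in C[t_1, ..., t_d]; p is the
   polynomial with real coefficients whose image there it is (unique, as
   R -> C is injective).  Existence is panoramic_polynomial_exists below. *)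
Definition panoramic_polynomial V (p : {mpoly R[\dim V]}) : Prop :=
  exists2 s : (\dim V).-tuple 'M[C]_n,
    hermitian_orthonormal_basis s & map_mpoly (real_complex R) p = \det (pencil s).

End QuantumGraphs.

Section OrthogonalEquivalence.
Variable R : realType.

Definition orthogonal_mx d (r : 'M[R]_d) : Prop := r *m r^T = 1%:M.

Definition linear_subst d (r : 'M[R]_d) (p : {mpoly R[d]}) : {mpoly R[d]} :=
  p \mPo [tuple \sum_(j < d) r i j *: 'X_j | i < d].

(* The polynomials may come with propositionally equal numbers of variables
   (the dimensions of two isomorphic spaces), hence the cast. *)
Definition orthogonally_equivalent d1 d2
    (p1 : {mpoly R[d1]}) (p2 : {mpoly R[d2]}) : Prop :=
  exists (e : d2 = d1) (r : 'M[R]_d1),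
    orthogonal_mx r /\ p1 = linear_subst r (ecast d {mpoly R[d]} e p2).

End OrthogonalEquivalence.

Section Existence.
Variables (R : realType) (n : nat).
Local Notation C := (R[i]).
Implicit Types (V W : {vspace 'M[C]_n}) (a b h : 'M[C]_n).

Lemma hermE a : (a \is hermsymmx) = (a == a ^t*).
Proof. by rewrite qualifE /= expr0 scale1r. Qed.

Lemma adjK a : (a ^t*) ^t* = a.
Proof. by apply/matrixP => i j; rewrite !mxE conjCK. Qed.

Lemma adjM a b : (a *m b) ^t* = b ^t* *m a ^t*.
Proof. by rewrite trmx_mul map_mxM. Qed.

Lemma adjD a b : (a + b) ^t* = a ^t* + b ^t*.
Proof. by apply/matrixP => i j; rewrite !mxE rmorphD. Qed.

Lemma adjZ c a : (c *: a) ^t* = c^* *: a ^t*.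
Proof. by apply/matrixP => i j; rewrite !mxE rmorphM. Qed.

Lemma mxtrace_adj a : \tr (a ^t*) = (\tr a)^*.
Proof. by rewrite /mxtrace rmorph_sum; apply: eq_bigr => i _; rewrite !mxE. Qed.

Lemma ntrJ a : normalized_trace (a ^t*) = (normalized_trace a)^*.
Proof. by rewrite /normalized_trace mxtrace_adj rmorphM fmorphV /= rmorph_nat. Qed.

Lemma trace_inner_linear a : linear (trace_inner a : 'M[C]_n -> C^o).
Proof.
move=> k x y; rewrite /trace_inner /normalized_trace mulmxDr -scalemxAr.
by rewrite mxtraceD mxtraceZ mulrDr mulrCA.
Qed.

HB.instance Definition _ a :=
  GRing.isLinear.Build C 'M[C]_n C^o *:%R (trace_inner a) (trace_inner_linear a).

Lemma trace_innerJ a b : trace_inner b a = (trace_inner a b)^*.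
Proof. by rewrite /trace_inner -ntrJ adjM adjK. Qed.

Lemma trace_inner_gt0 a : a != 0 -> 0 < trace_inner a a.
Proof.
move=> /matrix0Pn[i [j aij]].
have n0 : (0 < n)%N by apply: leq_ltn_trans (ltn_ord i).
rewrite /trace_inner /normalized_trace mulr_gt0 ?invr_gt0 ?ltr0n //.
have E k : (a ^t* *m a) k k = \sum_l `|a l k| ^+ 2.
  by rewrite mxE; apply: eq_bigr => l _; rewrite !mxE normCK mulrC.
have E0 k : 0 <= (a ^t* *m a) k k.
  by rewrite E; apply: sumr_ge0 => l _; rewrite exprn_ge0.
rewrite /mxtrace (bigD1 j) //= ltr_wpDr ?sumr_ge0 //.
rewrite E (bigD1 i) //= ltr_wpDr ?exprn_gt0 ?normr_gt0 //.
by rewrite sumr_ge0 // => l _; rewrite exprn_ge0.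
Qed.

Lemma trace_innerZ c a b :
  trace_inner (c *: a) (c *: b) = `|c| ^+ 2 * trace_inner a b.
Proof.
rewrite /trace_inner /normalized_trace adjZ -scalemxAl -scalemxAr !mxtraceZ.
by rewrite normCK; ring.
Qed.

Lemma hermitian_unit V : V != 0%VS -> (forall a, a \in V -> a ^t* \in V) ->
  exists h, [/\ h \in V, h ^t* = h & trace_inner h h = 1].
Proof.
move=> V0 adjV; have [h [hV hh h0]] : exists h, [/\ h \in V, h ^t* = h & h != 0].
  have [x0 xV] : vpick V != 0 /\ vpick V \in V by rewrite vpick0 memv_pick.
  move: (vpick V) x0 xV => x x0 xV.
  have [y0|y0] := eqVneq (x + x ^t*) 0; last first.
    exists (x + x ^t*); split=> //; first by rewrite memvD ?adjV.
    by rewrite adjD adjK addrC.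
  exists ('i%R *: x); split; first by rewrite memvZ.
    move/eqP: y0; rewrite addrC addr_eq0 => /eqP E.
    by rewrite adjZ E scalerN -scaleNr conjCi opprK.
  by rewrite scaler_eq0 negb_or x0 andbT neq0Ci.
have := trace_inner_gt0 h0; set N := trace_inner h h => N0.
have rN : (sqrtC N)^-1 \is Num.real by rewrite realV ger0_real // sqrtC_ge0 ltW.
exists ((sqrtC N)^-1 *: h); split; first by rewrite memvZ.
  by rewrite adjZ hh (CrealP rN).
by rewrite trace_innerZ normfV exprVn real_normK ?ger0_real ?sqrtC_ge0 ?ltW // sqrtCK mulVf ?gt_eqF.
Qed.

Lemma hermitian_seq V : (forall a, a \in V -> a ^t* \in V) ->
  exists s : seq 'M[C]_n, [/\ basis_of V s, all (mem hermsymmx) s &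
    {in s &, forall x y, trace_inner x y = (x == y)%:R}].
Proof.
have [k] := ubnP (\dim V); elim: k V => // k IH V ltk adjV.
have [->|V0] := eqVneq V 0%VS.
  by exists [::]; split=> //; rewrite basisEdim span_nil subvv dimv0.
have [h [hV hh h1]] := hermitian_unit V0 adjV.
pose f := linfun (trace_inner h : {linear 'M[C]_n -> C^o}).
have fE x : f x = trace_inner h x by rewrite lfunE.
pose V' := (V :&: lker f)%VS.
have V'E x : (x \in V') = (x \in V) && (trace_inner h x == 0).
  by rewrite memv_cap memv_ker fE.
have hV' : h \notin V' by rewrite V'E h1 oner_eq0 andbF.
have V'V : (V' <= V)%VS by apply: capvSl.
have ltV : (\dim V' < k)%N.
  rewrite -ltnS (leq_trans _ ltk) // ltnS ltn_neqAle dimvS // andbT.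
  by apply: contra hV' => /eqP E; have /eqP -> : V' == V by rewrite eqEdim V'V E /=.
have adjV' a : a \in V' -> a ^t* \in V'.
  rewrite !V'E => /andP[aV /eqP E]; rewrite adjV //=.
  suff -> : trace_inner h (a ^t*) = (trace_inner h a)^* by rewrite E conjC0.
  by rewrite /trace_inner -ntrJ adjM !hh /normalized_trace mxtrace_mulC.
have [s [sV sh so]] := IH V' ltV adjV'.
have /andP[/eqP sS sF] := sV.
have s0 x : x \in s -> trace_inner h x = 0.
  by move=> /(basis_mem sV); rewrite V'E => /andP[_ /eqP].
have hs : h \notin s by apply: contra hV' => /(basis_mem sV).
exists (h :: s); split.
- rewrite /basis_of free_cons sS hV' sF span_cons sS !andbT eqEsubv; apply/andP; split.
    by rewrite subv_add -memvE hV V'V.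
  apply/subvP => v vV; rewrite -[v](subrK (trace_inner h v *: h)) addrC.
  rewrite memv_add ?memvZ ?memv_line // V'E memvB ?memvZ //=.
  by rewrite addrC -scaleNr trace_inner_linear h1 [_ *: _]mulr1 addNr.
- by rewrite /= sh andbT hermE hh.
- move=> x y; rewrite !inE => /predU1P[->|xs] /predU1P[->|ys].
  + by rewrite h1 eqxx.
  + by rewrite s0 // ; case: eqP => // E; rewrite E ys in hs.
  + by rewrite trace_innerJ s0 // conjC0; case: eqP => // E; rewrite -E xs in hs.
  + exact: so.
Qed.

Lemma hermitian_orthonormal_basis_exists V : quantum_graph V ->
  exists s : (\dim V).-tuple 'M[C]_n, hermitian_orthonormal_basis s.
Proof.
move=> qV; have [s [sV sh so]] := hermitian_seq (fun a aV => proj2 (qV a aV)).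
have sz : size s == \dim V by have /andP[/eqP <- /eqP ->] := sV.
exists (Tuple sz); split=> //= [i j|i].
- rewrite so ?mem_tnth //; congr (nat_of_bool _)%:R.
  by rewrite !(tnth_nth 0) nth_uniq ?(eqP sz) //; apply: free_uniq (basis_free sV).
- by have /allP := sh; apply; apply: mem_tnth.
Qed.

Lemma map_mpoly_conj_real d (p : {mpoly C[d]}) : map_mpoly Num.conj p = p ->
  exists q : {mpoly R[d]}, map_mpoly (real_complex R) q = p.
Proof.
move=> pr; exists (\sum_(m <- msupp p) complex.Re p@_m *: 'X_[m]).
rewrite rmorph_sum /= [RHS]mpolyE; apply: eq_bigr => m _.
rewrite map_mpolyZ map_mpolyX; congr (_ *: _); apply: RRe_real.
by apply/CrealP; rewrite -[in LHS]mcoeff_map_mpoly pr.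
Qed.

Lemma panoramic_polynomial_exists V : quantum_graph V ->
  exists p, panoramic_polynomial (V := V) p.
Proof.
move=> /hermitian_orthonormal_basis_exists[s hs].
suff /map_mpoly_conj_real[p Ep] : map_mpoly Num.conj (\det (pencil s)) = \det (pencil s).
  by exists p, s.
rewrite -det_map_mx -[RHS]det_tr; congr (\det _); apply/matrixP => k l.
rewrite !mxE !summxE rmorph_sum; apply: eq_bigr => i _.
rewrite !mxE rmorphM /= map_mpolyX map_mpolyC /=; congr (_ * _%:MP).
have [_ _ /(_ i)] := hs; rewrite hermE => /eqP E.
by rewrite [in RHS]E !mxE.
Qed.

End Existence.

(* Main.v *)
(* Conjugating a Hermitian orthonormal basis (a_j) of R by the unitary u gives a
   Hermitian orthonormal basis (b_j) of S with
   det (sum_j t_j b_j) = det (sum_j t_j a_j).  Two Hermitian orthonormal bases of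
   S differ by the matrix of their mutual inner products, which is real since
   tr(xy) is real for Hermitian x, y, and orthogonal since both bases are
   orthonormal; substituting it in the pencil gives the equivalence. *)

Require Import Defs.
From mathcomp Require Import all_boot all_order all_algebra.
From mathcomp Require Import complex reals.
From mathcomp Require Import mpoly.

Local Open Scope ring_scope.

Set Implicit Arguments.
Unset Strict Implicit.
Unset Printing Implicit Defensive.

Import GRing.Theory Num.Theory.

Local Open Scope sesquilinear_scope.

Lemma map_mpoly_inj d (A B : nzRingType) (f : {additive A -> B}) :
  injective f -> injective (@map_mpoly d _ _ f).
Proof.
move=> inj_f p q /mpolyP E; apply/mpolyP => m; apply: inj_f.
by rewrite -(mcoeff_map_mpoly f m p) -(mcoeff_map_mpoly f m q); apply: E.
Qed.

Section Transition.
Variables (K : realType) (n : nat).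
Local Notation C := (K[i]).
Implicit Types (a b u : 'M[C]_n).

Lemma trace_inner_suml I (r : seq I) (c : I -> C) (f : I -> 'M[C]_n) b :
  trace_inner (\sum_(i <- r) c i *: f i) b
    = \sum_(i <- r) (c i)^* * trace_inner (f i) b.
Proof.
rewrite trace_innerJ linear_sum rmorph_sum; apply: eq_bigr => i _.
by rewrite linearZ /= [_ *: _]/(_ * _) rmorphM [in RHS]trace_innerJ.
Qed.

Lemma trace_inner_sumr I (r : seq I) (c : I -> C) (f : I -> 'M[C]_n) b :
  trace_inner b (\sum_(i <- r) c i *: f i)
    = \sum_(i <- r) c i * trace_inner b (f i).
Proof. by rewrite linear_sum; apply: eq_bigr => i _; rewrite linearZ. Qed.

(** Complex conjugation swaps the two arguments, and for Hermitian matrices cyclicity of the trace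
    swaps them back. *)
Lemma trace_inner_real a b : a \is hermsymmx -> b \is hermsymmx ->
  trace_inner a b \is Num.real.
Proof.
rewrite !hermE => /eqP ha /eqP hb; apply/CrealP.
rewrite -trace_innerJ /trace_inner -ha -hb.
by rewrite /normalized_trace mxtrace_mulC.
Qed.

(** Pairing any expansion of [x] along [t] with [tnth t i] isolates its [i]-th coefficient. *)
Lemma orthonormal_expansion d (t : d.-tuple 'M[C]_n) :
  (forall i j, trace_inner (tnth t i) (tnth t j) = (i == j)%:R) ->
  forall x, x \in <<t>>%VS ->
  x = \sum_(i < d) trace_inner (tnth t i) x *: tnth t i.
Proof.
move=> ot x xt; have E := coord_span xt.
rewrite [LHS]E; apply: eq_bigr => i _; rewrite -tnth_nth; congr (_ *: _).
rewrite [in RHS]E trace_inner_sumr (bigD1 i) //= -tnth_nth ot eqxx mulr1.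
by rewrite big1 ?addr0 // => j ji; rewrite -tnth_nth ot eq_sym (negPf ji) mulr0.
Qed.

Lemma orthogonal_transition d (s t : d.-tuple 'M[C]_n) :
  (forall i j, trace_inner (tnth s i) (tnth s j) = (i == j)%:R) ->
  (forall i j, trace_inner (tnth t i) (tnth t j) = (i == j)%:R) ->
  (forall i, tnth s i \is hermsymmx) -> (forall i, tnth t i \is hermsymmx) ->
  (forall j, tnth s j \in <<t>>%VS) ->
  exists2 r : 'M[K]_d, orthogonal_mx r &
    forall j, tnth s j = \sum_(i < d) (r i j)%:C%C *: tnth t i.
Proof.
move=> os ot hs ht st.
have [r rE] : exists r : 'M[K]_d,
    forall i j, (r i j)%:C%C = trace_inner (tnth t i) (tnth s j).
  exists (\matrix_(i, j) complex.Re (trace_inner (tnth t i) (tnth s j))) => i j.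
  by rewrite mxE RRe_real // trace_inner_real.
have sE j : tnth s j = \sum_(i < d) (r i j)%:C%C *: tnth t i.
  rewrite [LHS](orthonormal_expansion ot (st j)).
  by apply: eq_bigr => i _; rewrite rE.
(* It suffices that [r^T *m r = 1], as [r] is square. Expanding only [tnth s j] along [t] in the
   inner product of [tnth s j] and [tnth s k] gives entry [(j, k)] of this product. *)
exists r => //; apply: mulmx1C; apply/matrixP => j k.
apply: (@complexI K); rewrite !mxE rmorph_sum [RHS]rmorph_nat -os [in RHS](sE j).
rewrite trace_inner_suml; apply: eq_bigr => i _.
by rewrite -rE mxE rmorphM /= conj_Creal // rE trace_inner_real.
Qed.

Lemma pencilE d (s : d.-tuple 'M[C]_n) k l :
  pencil s k l = \sum_(i < d) 'X_i * (tnth s i k l)%:MP.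
Proof. by rewrite summxE; apply: eq_bigr => i _; rewrite !mxE. Qed.

(** Replacing each ['X_i] by the sum of the [r i j *: 'X_j] turns the pencil of [t] into that of
    [s], and substitution, being a ring morphism, commutes with the determinant. *)
Lemma linear_subst_pencil d (s t : d.-tuple 'M[C]_n) (r : 'M[K]_d)
    (p q : {mpoly K[d]}) :
  (forall j, tnth s j = \sum_(i < d) (r i j)%:C%C *: tnth t i) ->
  map_mpoly (real_complex K) p = \det (pencil s) ->
  map_mpoly (real_complex K) q = \det (pencil t) ->
  p = linear_subst r q.
Proof.
move=> sE Ep Eq; apply: (map_mpoly_inj (@complexI K)).
rewrite /linear_subst map_mpoly_comp; last exact: complexI.
set lq := [tuple of _].
have lqE i : tnth lq i = \sum_(j < d) (r i j)%:C%C *: 'X_j.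
  rewrite tnth_map tnth_mktuple rmorph_sum /=.
  by apply: eq_bigr => j _; rewrite map_mpolyZ map_mpolyX.
rewrite Ep Eq -det_map_mx; congr (\det _); apply/matrixP => k l.
move: lq lqE => lq lqE. (* hiding the body of lq keeps unification fast *)
rewrite [RHS]mxE [LHS]pencilE (pencilE t k l) [RHS]rmorph_sum.
(* Both entries equal this double sum: the left one by expanding [tnth s j], the right one by
   substituting for ['X_i] and exchanging the sums. *)
transitivity (\sum_(j < d) \sum_(i < d)
    'X_j * ((r i j)%:C%C * tnth t i k l)%:MP : {mpoly C[d]}).
  apply: eq_bigr => j _; rewrite -mulr_sumr -rmorph_sum; congr (_ * _%:MP).
  by rewrite sE summxE; apply: eq_bigr => i _; rewrite mxE.
rewrite exchange_big; apply: eq_bigr => i _ /=.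
rewrite rmorphM /= comp_mpolyC comp_mpolyXU -tnth_nth lqE mulr_suml.
apply: eq_bigr => j _.
by rewrite mpolyCM mulrA; congr (_ * _); rewrite mulrC mul_mpolyC.
Qed.

(** The pencil is itself conjugated by the constant matrix [u], and the determinants of [u] and
    [u ^t*] multiply to 1. *)
Lemma det_pencil_conj d (s : d.-tuple 'M[C]_n) u : u \is unitarymx ->
  \det (pencil [tuple u *m tnth s i *m u ^t* | i < d]) = \det (pencil s).
Proof.
move=> /unitarymxP uu.
pose f := @mpolyC d C.
have -> : pencil [tuple u *m tnth s i *m u ^t* | i < d]
    = map_mx f u *m pencil s *m map_mx f (u ^t*).
  rewrite /pencil mulmx_sumr mulmx_suml; apply: eq_bigr => i _.
  by rewrite tnth_mktuple !map_mxM -scalemxAr -scalemxAl.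
by rewrite !det_mulmx mulrAC -det_mulmx -map_mxM uu map_mx1 det1 mul1r.
Qed.

Lemma trace_inner_conj u a b : u \is unitarymx ->
  trace_inner (u *m a *m u ^t*) (u *m b *m u ^t*) = trace_inner a b.
Proof.
move=> uu; have uu' : u ^t* *m u = 1%:M by apply/mulmx1C/unitarymxP.
rewrite /trace_inner /normalized_trace !adjM adjK; congr (_ * _).
rewrite -!mulmxA mxtrace_mulC -!mulmxA uu' mulmx1.
by rewrite [u ^t* *m _]mulmxA uu' mul1mx.
Qed.

Lemma hermsymmx_conj u a : a \is hermsymmx -> u *m a *m u ^t* \is hermsymmx.
Proof. by rewrite !hermE => /eqP ha; rewrite !adjM adjK -ha mulmxA. Qed.

Lemma dim_quantum_graph_isomorphic (V W : {vspace 'M[C]_n}) :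
  quantum_graph_isomorphic V W -> \dim W = \dim V.
Proof.
case=> u uu uVW; have uu' : u ^t* *m u = 1%:M by apply/mulmx1C/unitarymxP.
pose f := linfun (mulmxr (u ^t*) \o mulmx u : 'M[C]_n -> 'M[C]_n).
have fE a : f a = u *m a *m u ^t* by rewrite lfunE.
have -> : W = (f @: V)%VS.
  apply/vspaceP => b; apply/idP/memv_imgP => [/uVW[a aV ->]|[a aV ->]].
    by exists a.
  by apply/uVW; exists a.
rewrite limg_dim_eq //; apply/eqP; rewrite -subv0; apply/subvP => a.
rewrite memv_cap memv_ker memv0 fE.
case/andP=> _ /eqP E; apply/eqP.
(* Injectivity: [a] is recovered from [u *m a *m u ^t*] by conjugating back with [u ^t*]. *)
rewrite -[a]mul1mx -uu' -[_ *m a]mulmx1 -uu' -!mulmxA (mulmxA u).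
by rewrite (mulmxA (_ *m _)) E mul0mx mulmx0.
Qed.

(** With [d1] and [d2] variables, [e] can be eliminated and the cast disappears; this is impossible
    directly for [\dim R] and [\dim S]. *)
Lemma orthogonally_equivalent_pencil d1 d2 (e : d2 = d1)
    (s : d1.-tuple 'M[C]_n) (t : d2.-tuple 'M[C]_n)
    (p : {mpoly K[d1]}) (q : {mpoly K[d2]}) :
  (forall i j, trace_inner (tnth s i) (tnth s j) = (i == j)%:R) ->
  (forall i j, trace_inner (tnth t i) (tnth t j) = (i == j)%:R) ->
  (forall i, tnth s i \is hermsymmx) -> (forall i, tnth t i \is hermsymmx) ->
  (forall j, tnth s j \in <<t>>%VS) ->
  map_mpoly (real_complex K) p = \det (pencil s) ->
  map_mpoly (real_complex K) q = \det (pencil t) ->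
  orthogonally_equivalent p q.
Proof.
case: d1 / e s p => s p os ot hs ht st Ep Eq.
have [r orr sE] := orthogonal_transition os ot hs ht st.
by exists erefl, r; split=> //; apply: linear_subst_pencil sE Ep Eq.
Qed.

End Transition.

Theorem proposition3p11 (K : realType) (n : nat) (R S : {vspace 'M[K[i]]_n})
    (qgR : quantum_graph R) (qgS : quantum_graph S)
    (isoRS : quantum_graph_isomorphic R S)
    (pR : {mpoly K[\dim R]}) (pS : {mpoly K[\dim S]})
    (panR : panoramic_polynomial pR) (panS : panoramic_polynomial pS) :
  orthogonally_equivalent pR pS.
Proof.
have e := dim_quantum_graph_isomorphic isoRS.
case: panR => s [bs os hs] Es; case: panS => t [bt ot ht] Et.
case: isoRS => u uu uRS.
(* The conjugated basis of [R] is compared with the basis [t] inside [S]. *)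
apply: (orthogonally_equivalent_pencil e
  (s := [tuple u *m tnth s i *m u ^t* | i < \dim R]) _ ot _ ht _ _ Et).
- by move=> i j; rewrite !tnth_mktuple trace_inner_conj.
- by move=> i; rewrite tnth_mktuple hermsymmx_conj.
- move=> j; rewrite tnth_mktuple (span_basis bt); apply/uRS.
  by exists (tnth s j) => //; apply: (basis_mem bs); apply: mem_tnth.
- by rewrite det_pencil_conj.
Qed.
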